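(* Let $k$ and $r$ be positive integers with $r\ge 2$ and $k\le r$, and let $G$ be a graph with $\chi(G)\le r$. Let $P\subset V(G)$ and let $d\colon P\to[r+k]$ be a precoloring of $P$ in $G$. (1) If $r+k\equiv 0\pmod 2$ and $|\mathcal{D}_G(P,2)|<2(r+k-1)$, then $d$ can be extended to a $\frac{3r+k}{2}$-coloring of $G$. (2) If $r+k\equiv 1\pmod 2$, $r+k\ge 13$ and $|\mathcal{D}_G(P,2)|<3(r+k-1)$, then $d$ can be extended to a $\frac{3r+k+1}{2}$-coloring of $G$.
   Context: For a graph $G$, $P\subset V(G)$ and a positive integer $k$, $\mathcal{D}_G(P,k)=\{\{x,y\}\subset P: x\ne y,\ d_G(x,y)\le k\}$, where $d_G$ is the distance in $G$. $[m]=\{1,\dots,m\}$. A precoloring of $P$ in $G$ is a proper coloring of $G[P]$; an $m$-coloring of $G$ is a proper coloring using at most $m$ colors; $d$ is extended by a coloring $f$ of $G$ if $f(v)=d(v)$ for all $v\in P$. *)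

(* Defs.v *)
From mathcomp Require Import all_boot.
Set Implicit Arguments. Unset Strict Implicit. Unset Printing Implicit Defensive.

(* A finite simple graph is a symmetric irreflexive relation e on a finType T.
   Colors are natural numbers; [m] = {1,...,m}. *)

Fixpoint within (T : finType) (e : rel T) (n : nat) (x y : T) : bool :=
  match n with
  | 0 => x == y
  | n'.+1 => (x == y) || [exists z, e x z && within e n' z y]
  end.

Definition DG (T : finType) (e : rel T) (P : {set T}) (k : nat) : {set {set T}} :=
  [set s : {set T} | (s \subset P) && (#|s| == 2) &&
     [forall x in s, forall y in s, within e k x y]].

Definition mcoloring (T : finType) (e : rel T) (m : nat) (f : T -> nat) : Prop :=
  (forall v, 1 <= f v <= m) /\ (forall x y, e x y -> f x <> f y).

Definition chi_le (T : finType) (e : rel T) (r : nat) : Prop :=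
  exists f, mcoloring e r f.

Definition precoloring (T : finType) (e : rel T) (P : {set T}) (c : nat)
  (d : T -> nat) : Prop :=
  (forall v, v \in P -> 1 <= d v <= c) /\
  (forall x y, x \in P -> y \in P -> e x y -> d x <> d y).

Definition extends_to (T : finType) (e : rel T) (P : {set T}) (d : T -> nat)
  (m : nat) : Prop :=
  exists f, mcoloring e m f /\ (forall v, v \in P -> f v = d v).

(* Main.v *)
Require Import Defs.
From mathcomp Require Import all_boot zify.

(** Put n = r + k and fix a proper coloring of G with classes 0, ..., r - 1. Give
    each of the first m classes its own pair of colors of [n], the m pairs being
    disjoint, and each other class a color above n. A vertex outside P in a class
    with pair {a, b} is stuck only if it sees both a and b on P; its two
    neighbors then form an element of D_G(P,2). Weight a pair of colors by the
    number of elements of D_G(P,2) that carry it. A (near-)perfect matching of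
    [n] of weight at most 1 is enough: the only conflicting pair {x, y}, if any,
    is harmless for the class of x.

    For n even, exchanging two pairs of a minimum weight perfect matching, of
    weight mu, bounds the total weight below by mu (n - 1).

    For n = 2p + 3, suppose that all near-perfect matchings have weight at least
    2, with the total weight minimal; then every positive pair lies in a matching
    of weight exactly 2. If some pair ab has weight 2, and u is the missed color,
    then abu is a triangle of weights 2 sending weight 6 to each zero pair of the
    matching, for a total of 6p + 6. Otherwise all weights are 0 or 1; the two
    pairs of weight 1 and the missed color span a K5, and counting what the p - 1
    zero pairs send to it and to each other again gives 6p + 6 when p >= 5. *)

Set Implicit Arguments. Unset Strict Implicit. Unset Printing Implicit Defensive.

(* [lia] would otherwise split on every boolean coerced to nat. *)
Ltac count_lia :=
  repeat match goal with X := _ : seq _ |- _ => subst X end;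
  rewrite /=; repeat match goal with |- context [nat_of_bool ?b] =>
    move: (nat_of_bool b) => ? end; lia.
Ltac perm_lia := let Q := fresh in apply/permP=> Q; count_lia.
Ltac perm_lia_with H := let Q := fresh in
  apply/permP=> Q; move/permP/(_ Q): H; count_lia.

(** * Matchings as lists of pairs *)

Section PairLists.
Variable V : eqType.
Implicit Types (M : seq (V * V)) (s : seq V) (w : V -> V -> nat).

(** A matching is a list of pairs [M]: it is perfect when [flat M] is a permutation of [enum V], and
    near-perfect with missed point [u] when [u :: flat M] is one. *)
Fixpoint flat M := if M is e :: M' then e.1 :: e.2 :: flat M' else [::].

(** Turns a permutation of the points into a matching, so that the existence of a light matching is
    decided over the finite list [permutations (enum V)]. *)
Fixpoint pairup s := if s is x :: y :: s' then (x, y) :: pairup s' else [::].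

Definition weight w M := \sum_(e <- M) w e.1 e.2.

Definition cross w s t := \sum_(x <- s) \sum_(y <- t) w x y.

Lemma sum_seq_const (s : seq (V * V)) c : \sum_(e <- s) c = size s * c.
Proof. by rewrite big_const_seq count_predT iter_addn addn0 mulnC. Qed.

Lemma size_flat M : size (flat M) = (size M).*2.
Proof. by elim: M => //= e M ->; rewrite doubleS. Qed.

Lemma flatK : cancel flat pairup.
Proof. by elim=> //= -[x y] M ->. Qed.

Lemma pairupK s : ~~ odd (size s) -> flat (pairup s) = s.
Proof.
have [n] := ubnP (size s); elim: n s => // n IH [|x [|y s]] //= lt_n ev.
rewrite IH //; first by lia.
by move: ev; rewrite negbK.
Qed.

Lemma perm_flat M N : perm_eq M N -> perm_eq (flat M) (flat N).
Proof.
have flatE K : flat K = flatten [seq [:: e.1; e.2] | e <- K] by elim: K => //= e K ->.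
by move=> MN; rewrite !flatE; apply/perm_flatten/perm_map.
Qed.

Lemma mem_flat e M : e \in M -> (e.1 \in flat M) && (e.2 \in flat M).
Proof.
move=> eM; have := perm_mem (perm_flat (perm_to_rem eM)).
by move=> E; rewrite !E /= !inE !eqxx ?orbT.
Qed.

Lemma weight_cons w e M : weight w (e :: M) = w e.1 e.2 + weight w M.
Proof. by rewrite /weight big_cons. Qed.

Lemma perm_weight w M N : perm_eq M N -> weight w M = weight w N.
Proof. exact: perm_big. Qed.

Lemma weight0_mem w M e : weight w M = 0 -> e \in M -> w e.1 e.2 = 0.
Proof.
move=> M0 eM; move: M0; rewrite (perm_weight _ (perm_to_rem eM)) weight_cons.
by lia.
Qed.

Lemma weight_gt0 w M : 0 < weight w M -> exists2 e, e \in M & 0 < w e.1 e.2.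
Proof.
elim: M => [|e M IH]; first by rewrite /weight big_nil.
rewrite weight_cons; case: (posnP (w e.1 e.2)) => [-> /IH[f fM wf]|we _].
  by exists f => //; rewrite inE fM orbT.
by exists e; rewrite ?mem_head.
Qed.

Lemma cross_flat w s M : cross w s (flat M) = \sum_(f <- M) cross w s [:: f.1; f.2].
Proof.
rewrite /cross [RHS]exchange_big /=; apply: eq_bigr => x _.
elim: M => [|f M IH]; first by rewrite !big_nil.
by rewrite /= !big_cons IH big_nil addn0 addnA.
Qed.

Lemma perm_cross w s s' t t' :
  perm_eq s s' -> perm_eq t t' -> cross w s t = cross w s' t'.
Proof.
move=> ss' tt'; rewrite /cross (perm_big _ ss') /=.
by apply: eq_bigr => x _; apply: perm_big.
Qed.

Lemma cross_cat w s t : (forall x y, w x y = w y x) ->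
  cross w (s ++ t) (s ++ t) = cross w s s + 2 * cross w s t + cross w t t.
Proof.
move=> wC; rewrite /cross big_cat /=.
rewrite (eq_bigr (fun x => \sum_(y <- s) w x y + \sum_(y <- t) w x y));
  last by move=> x _; rewrite big_cat.
rewrite [X in _ + X](eq_bigr (fun x => \sum_(y <- s) w x y + \sum_(y <- t) w x y));
  last by move=> x _; rewrite big_cat.
rewrite !big_split /= [X in _ + (X + _)]exchange_big /=.
rewrite [X in _ + (X + _)](eq_bigr (fun x => \sum_(y <- t) w x y)); first by lia.
by move=> x _; apply: eq_bigr => y _.
Qed.

(** Any two entries can be moved to the front, so an exchange argument need only treat lists of the
    form [e :: f :: N]. *)
Lemma pairwise_perm (r : rel (V * V)) M :
  (forall e f N, perm_eq M (e :: f :: N) -> r e f) -> pairwise r M.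
Proof.
elim: M => //= e M IH H; apply/andP; split.
  by apply/allP=> f fM; apply: (H _ _ (rem f M)); rewrite perm_cons perm_to_rem.
apply: IH => f g N MN; apply: (H _ _ (e :: N)).
rewrite (perm_trans (_ : perm_eq _ (e :: f :: g :: N))) ?perm_cons //.
perm_lia.
Qed.

End PairLists.

Lemma flat_map_pair (A B : eqType) (g : A -> B) (M : seq (A * A)) :
  flat [seq (g p.1, g p.2) | p <- M] = [seq g a | a <- flat M].
Proof. by elim: M => //= p M ->. Qed.

Lemma nth_flat (M : seq (nat * nat)) i : i < size M ->
  nth 0 (flat M) i.*2 = (nth (0, 0) M i).1 /\
  nth 0 (flat M) i.*2.+1 = (nth (0, 0) M i).2.
Proof. by elim: M i => [|p M IH] [|i] //= /IH. Qed.

Lemma uniq_flat_disjoint (M : seq (nat * nat)) i j x : uniq (flat M) ->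
  i < size M -> j < size M ->
  x \in [:: (nth (0, 0) M i).1; (nth (0, 0) M i).2] ->
  x \in [:: (nth (0, 0) M j).1; (nth (0, 0) M j).2] -> i = j.
Proof.
move=> uM iM jM; have [<- <-] := nth_flat iM; have [<- <-] := nth_flat jM.
by rewrite !inE => /orP[]/eqP-> /orP[];
  rewrite nth_uniq ?size_flat ?ltn_Sdouble ?ltn_double //; lia.
Qed.

(* Each unordered pair is counted twice. *)
Definition wtotal (V : finType) (u : V -> V -> nat) := \sum_x \sum_y u x y.

Lemma total_perm (V : finType) (u : V -> V -> nat) s :
  perm_eq s (enum V) -> cross u s s = wtotal u.
Proof.
move=> sV; rewrite (perm_cross _ sV sV) /cross /wtotal big_enum.
by apply: eq_bigr => x _; rewrite big_enum.
Qed.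

(** * Light perfect matchings on an even number of points *)

Section EvenMatching.
Variables (V : finType) (w : V -> V -> nat).
Hypothesis wC : forall x y, w x y = w y x.

(** With [s] pairs of total weight [W], each pair meets [s - 1] others: the hypothesis, counted in
    both orders, gives at least [4 (s - 1) W], and the pairs themselves add at least [2 W]. *)
Lemma cross_flat_ge (M : seq (V * V)) :
    pairwise (fun e f => 2 * (w e.1 e.2 + w f.1 f.2) <=
                         cross w [:: e.1; e.2] [:: f.1; f.2]) M ->
  4 * size M * weight w M <= cross w (flat M) (flat M) + 2 * weight w M.
Proof.
elim: M => [|e M IH] /=; first by rewrite /weight big_nil muln0.
case/andP=> /allP eM /IH {}IH.
rewrite -[e.1 :: _]/([:: e.1; e.2] ++ flat M) cross_cat //.
have le1: \sum_(f <- M) 2 * (w e.1 e.2 + w f.1 f.2) <= cross w [:: e.1; e.2] (flat M).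
  by rewrite cross_flat big_seq [leqRHS]big_seq; apply: leq_sum => f /eM.
have le2: 2 * w e.1 e.2 <= cross w [:: e.1; e.2] [:: e.1; e.2].
  rewrite /cross !big_cons !big_nil [w e.2 e.1]wC; lia.
move: le1; rewrite -big_distrr big_split /= sum_seq_const.
rewrite -/(weight w M) weight_cons; move: IH le2.
set A := cross _ (flat M) _; set B := cross _ _ (flat M); set C := cross _ _ _.
by move: A B C (size M) (weight w M) (w _ _) => A B C s W v; nia.
Qed.

Lemma even_matching_contra : wtotal w < 4 * #|V|.-1 ->
  (forall M, perm_eq (flat M) (enum V) -> 2 <= weight w M) ->
  forall M, perm_eq (flat M) (enum V) -> False.
Proof.
move=> small min2 M; have [m] := ubnP (weight w M).
elim: m M => // m IH M lt_m MV.
have minM N : perm_eq (flat N) (enum V) -> weight w M <= weight w N.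
  move=> NV; case: leqP => // lt_NM; case: (IH N) => //; lia.
have szM : #|V| = (size M).*2 by rewrite cardE -(perm_size MV) size_flat.
have := @cross_flat_ge M; rewrite (total_perm _ MV) => H.
suff /H: pairwise (fun e f => 2 * (w e.1 e.2 + w f.1 f.2) <=
                         cross w [:: e.1; e.2] [:: f.1; f.2]) M.
  (* Since [W >= 2], the bound [(4 s - 2) W <= wtotal w] contradicts [wtotal w < 4 (2 s - 1)]. *)
  move: (min2 _ MV) small; rewrite szM -muln2.
  by move: (size M) (weight w M) (wtotal w) => s W t; case: s => [|s]; nia.
apply: pairwise_perm => -[a b] [c d] N MN.
have NV : perm_eq (flat ((a, b) :: (c, d) :: N)) (enum V).
  by rewrite (perm_trans _ MV) // perm_sym perm_flat.
(* Neither of the other two pairings of the four points lowers the weight; the two inequalities add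
   up to the exchange bound. *)
have := minM ((a, c) :: (b, d) :: N); have := minM ((a, d) :: (b, c) :: N).
rewrite (perm_weight _ MN) !weight_cons /cross !big_cons !big_nil /=.
have P1 : perm_eq (flat ((a, d) :: (b, c) :: N)) (enum V).
  by apply: perm_trans NV; perm_lia.
have P2 : perm_eq (flat ((a, c) :: (b, d) :: N)) (enum V).
  by apply: perm_trans NV; perm_lia.
move=> /(_ P1) h1 /(_ P2) h2; lia.
Qed.

Lemma even_matching : ~~ odd #|V| -> wtotal w < 4 * #|V|.-1 ->
  exists2 M, perm_eq (flat M) (enum V) & weight w M <= 1.
Proof.
move=> ev small.
have fl s : perm_eq s (enum V) -> flat (pairup s) = s.
  by move=> sV; rewrite pairupK // (perm_size sV) -cardE.
case: (boolP (all (fun s => 2 <= weight w (pairup s)) (permutations (enum V)))).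
  move/allP=> min2; case: (even_matching_contra small _ (M := pairup (enum V))) => //.
    move=> M MV; have := min2 (flat M); rewrite flatK; apply.
    by rewrite mem_permutations.
  by rewrite fl.
case/allPn=> s; rewrite mem_permutations -ltnNge => sV ws.
by exists (pairup s); rewrite ?fl.
Qed.

End EvenMatching.

(** * Light near-perfect matchings on an odd number of points *)

Section OddMatching.
Variable V : finType.
Implicit Type w : V -> V -> nat.

(* In a counterexample of least total weight [decr] must break the property
   [near_perfect_ge2], so every positive pair lies in a near-perfect matching of
   weight exactly 2: the hypothesis [tight] below. *)
Definition decr w x y a b := w a b - ((a == x) && (b == y)) - ((a == y) && (b == x)).

Lemma decr_sym w x y : (forall a b, w a b = w b a) ->
  forall a b, decr w x y a b = decr w x y b a.
Proof. by move=> wC a b; rewrite /decr wC; lia. Qed.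

Lemma total_decr w x y : 0 < w x y -> wtotal (decr w x y) < wtotal w.
Proof.
move=> wxy; have le a b : decr w x y a b <= w a b by rewrite /decr; lia.
have lt : decr w x y x y < w x y by rewrite /decr !eqxx /=; lia.
have row : \sum_b decr w x y x b < \sum_b w x b.
  rewrite (bigD1 y) //= [\sum_b w x b](bigD1 y) //=.
  by rewrite -addSn leq_add // leq_sum.
rewrite /wtotal (bigD1 x) //= [\sum_a \sum_b w a b](bigD1 x) //= -addSn leq_add //.
by apply: leq_sum => a _; apply: leq_sum.
Qed.

Lemma weight_decr w x y M : (x, y) \notin M -> (y, x) \notin M ->
  weight (decr w x y) M = weight w M.
Proof.
move=> xyM yxM; apply: eq_big_seq => -[a b] abM; rewrite /decr /= -!xpair_eqE.
have -> : ((a, b) == (x, y)) = false by apply: contraNF xyM => /eqP <-.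
have -> : ((a, b) == (y, x)) = false by apply: contraNF yxM => /eqP <-.
by rewrite !subn0.
Qed.

Definition near_perfect_ge2 w :=
  forall u M, perm_eq (u :: flat M) (enum V) -> 2 <= weight w M.

(** Only matchings containing the pair get lighter, and by at most 1; they weigh at least 2 and not
    exactly 2, so at least 3 before the decrease. *)
Lemma near_perfect_ge2_decr w x y : x != y ->
  (forall a b, w a b = w b a) -> near_perfect_ge2 w ->
  (forall u M, perm_eq (u :: flat ((x, y) :: M)) (enum V) ->
     w x y + weight w M <> 2) ->
  near_perfect_ge2 (decr w x y).
Proof.
move=> xy wC min2 ntight.
have key u M : perm_eq (u :: flat ((x, y) :: M)) (enum V) ->
    3 <= w x y + weight w M /\ weight (decr w x y) M = weight w M.
  move=> MV; have := ntight _ _ MV; have := min2 _ _ MV; rewrite weight_cons /=.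
  split; first by lia.
  have : uniq (u :: flat ((x, y) :: M)) by rewrite (perm_uniq MV) enum_uniq.
  rewrite /= => /and4P[_ + + _]; rewrite inE negb_or => /andP[_ xM] yM.
  apply: weight_decr; first by apply: contra xM => /mem_flat /andP[].
  by apply: contra yM => /mem_flat /andP[].
move=> u M MV; case: (boolP ((x, y) \in M)) => [xyM|xyM].
  have MN := perm_to_rem xyM.
  have MV' : perm_eq (u :: flat ((x, y) :: rem (x, y) M)) (enum V).
    by rewrite (perm_trans _ MV) // perm_cons perm_sym perm_flat.
  have [] := key _ _ MV'; rewrite (perm_weight _ MN) weight_cons /decr /= !eqxx.
  by rewrite (negbTE xy) /= => ? ->; lia.
case: (boolP ((y, x) \in M)) => [yxM|yxM]; last by rewrite weight_decr // (min2 u).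
have MN := perm_to_rem yxM.
have MV' : perm_eq (u :: flat ((x, y) :: rem (y, x) M)) (enum V).
  rewrite (perm_trans _ MV) // perm_cons perm_sym (perm_trans (perm_flat MN)) //.
  perm_lia.
have [] := key _ _ MV'; rewrite (perm_weight _ MN) weight_cons /decr /= !eqxx.
by rewrite eq_sym (negbTE xy) (wC y x) /= => ? ->; lia.
Qed.

Section Tight.
Variable w : V -> V -> nat.
Hypotheses (wC : forall a b, w a b = w b a) (w0 : forall a, w a a = 0).
Hypothesis min2 : near_perfect_ge2 w.
(* The double negation spares an excluded middle over all matchings. *)
Hypothesis tight : forall x y, 0 < w x y ->
  ~ ~ exists u M, perm_eq (u :: flat ((x, y) :: M)) (enum V) /\ w x y + weight w M = 2.

Lemma perm_rem_flat (s : seq V) (z : seq (V * V)) f : f \in z ->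
  perm_eq (s ++ flat z) (enum V) ->
  perm_eq (s ++ f.1 :: f.2 :: flat (rem f z)) (enum V).
Proof.
move=> fz; apply: perm_trans; rewrite perm_cat2l perm_sym.
exact: perm_flat (perm_to_rem fz).
Qed.

Lemma size_near_perfect u M : perm_eq (u :: flat M) (enum V) -> #|V| = (size M).*2.+1.
Proof. by move=> MV; rewrite cardE -(perm_size MV) /= size_flat. Qed.

Lemma weight_le2 x y : w x y <= 2.
Proof.
case: leqP => // w3; exfalso; apply: (@tight x y); first by lia.
by move=> [u [M [_ ?]]]; lia.
Qed.

Lemma total_edge2 a b : w a b = 2 -> 6 * #|V|.-1 <= wtotal w.
Proof.
move=> wab; case: leqP => // small; exfalso; apply: (@tight a b); first by lia.
move=> [u [z [MV wz]]]; have {}wz : weight w z = 0 by lia.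
(* Trading the pair [ab] for [au] leaves [b] missed. The rest weighs 0, so [w a u] alone must reach
   2. *)
have wau : w a u = 2.
  have := min2 (u := b) (M := (a, u) :: z); rewrite weight_cons wz /=.
  have := weight_le2 a u; rewrite (perm_trans _ MV); first by lia.
  perm_lia.
have wbu : w b u = 2.
  have := min2 (u := a) (M := (b, u) :: z); rewrite weight_cons wz /=.
  have := weight_le2 b u; rewrite (perm_trans _ MV); first by lia.
  perm_lia.
have MV' : perm_eq ([:: u; a; b] ++ flat z) (enum V) by [].
have crz f : f \in z -> 6 <= cross w [:: u; a; b] [:: f.1; f.2].
  move=> fz; have {}MV := perm_rem_flat fz MV'.
  have wz' : weight w (rem f z) = 0.
    by move: wz; rewrite (perm_weight _ (perm_to_rem fz)) weight_cons; lia.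
  move: (rem f z) MV wz' => z'; case: f {fz} => x y /= MV wz'.
  (* Two triangle points take [x] and [y] as partners and the third is missed. *)
  have key p q t : perm_eq [:: p; q; t] [:: u; a; b] -> 2 <= w p x + w q y.
    move=> pqt; have := min2 (u := t) (M := (p, x) :: (q, y) :: z').
    rewrite !weight_cons wz' /= addn0; apply; rewrite (perm_trans _ MV) //.
    perm_lia_with pqt.
  (* The six inequalities count each of the six edges to [x] and [y] twice, whence 6. *)
  have k1 := key u a b ltac:(perm_lia); have k2 := key a u b ltac:(perm_lia).
  have k3 := key u b a ltac:(perm_lia); have k4 := key b u a ltac:(perm_lia).
  have k5 := key a b u ltac:(perm_lia); have k6 := key b a u ltac:(perm_lia).
  by rewrite /cross !big_cons !big_nil; lia.
have szV := size_near_perfect MV.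
move: small; rewrite -(total_perm _ MV') cross_cat // cross_flat.
have le1 : \sum_(f <- z) 6 <= \sum_(f <- z) cross w [:: u; a; b] [:: f.1; f.2].
  by rewrite big_seq [leqRHS]big_seq; apply: leq_sum.
move: le1; rewrite sum_seq_const.
have -> : cross w [:: u; a; b] [:: u; a; b] = 12.
  by rewrite /cross !big_cons !big_nil !w0 (wC b a) (wC u a) (wC u b) wab wau wbu.
(* The triangle's 12 plus twice 6 for each zero pair is [6 * (2 * size z + 2)], where
   [#|V| = 2 * size z + 3]. *)
rewrite szV /= => le1; lia.
Qed.

(** With [s] light pairs among [m], twice the weight sent to [Q] is at least [16 m - 6 s], and the
    light pairs send each other at least [s (s - 1)] in both orders together. *)
Lemma cross_light_ge (Q : seq V) (z : seq (V * V)) (light : pred (V * V)) :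
    (forall f, f \in z -> (if light f then 5 else 8) <= cross w Q [:: f.1; f.2]) ->
    pairwise (fun e f => light e ==> light f ==>
                         (1 <= cross w [:: e.1; e.2] [:: f.1; f.2])) z ->
  16 * size z + count light z * count light z <=
  2 * cross w Q (flat z) + cross w (flat z) (flat z) + 7 * count light z.
Proof.
rewrite cross_flat; elim: z => [|e z IH] //= crQ /andP[/allP ez /IH {}IH].
have {}IH := IH (fun f fz => crQ f (@mem_behead _ (e :: z) f fz)).
rewrite big_cons -[[:: e.1, e.2 & flat z]]/([:: e.1; e.2] ++ flat z) cross_cat //.
have := crQ e (mem_head _ _); case: ifP => le /=; first last.
  by move: IH; set A := \sum_(_ <- _) _; lia.
have le1 : count light z <= cross w [:: e.1; e.2] (flat z).
  rewrite cross_flat -sum1_count big_mkcond big_seq [leqRHS]big_seq.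
  by apply: leq_sum => f /ez; rewrite le; case: (light f).
move: IH le1; set A := \sum_(_ <- _) _; set B := cross w _ (flat z).
set C := cross w [:: _; _] _; set D := cross w _ _.
by move: A B C D (count _ _) (size z) => A B C D s m; nia.
Qed.

Lemma total_edge1 a b : (forall x y, w x y <= 1) -> 13 <= #|V| -> 0 < w a b ->
  6 * #|V|.-1 <= wtotal w.
Proof.
move=> w1 V13 wab; case: leqP => // small; exfalso; apply: (tight wab).
move=> [u [M [MV wM]]]; have {wM}wM : weight w M = 1 by have := w1 a b; lia.
have [[c d] cdM /= wcd] : exists2 e, e \in M & 0 < w e.1 e.2.
  by apply: weight_gt0; rewrite wM.
set z := rem (c, d) M; pose Q := [:: a; b; c; d; u].
have wz : weight w z = 0.
  by move: wM; rewrite (perm_weight _ (perm_to_rem cdM)) weight_cons -/z /=; lia.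
have {cdM}MV : perm_eq (Q ++ flat z) (enum V).
  have := @perm_rem_flat [:: u; a; b] _ _ cdM MV; apply: perm_trans.
  perm_lia.
(* Any two disjoint pairs inside [Q] complete [z] to a near-perfect matching, so both must have
   weight 1. *)
have K5 p1 p2 p3 p4 p5 : perm_eq [:: p1; p2; p3; p4; p5] Q -> w p1 p2 = 1.
  move=> pQ; have := min2 (u := p5) (M := (p1, p2) :: (p3, p4) :: z).
  rewrite !weight_cons wz /= (perm_trans _ MV).
    by have := w1 p1 p2; have := w1 p3 p4; lia.
  perm_lia_with pQ.
have zero_edge x y z' : perm_eq (Q ++ x :: y :: flat z') (enum V) ->
    weight w z' = 0 -> 5 <= cross w Q [:: x; y] /\
      (cross w Q [:: x; y] <= 7 -> cross w Q [:: x] <= 2 \/ cross w Q [:: y] <= 2).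
  move=> {}MV wz'.
  (* By [key], no point of [Q] unjoined to [x] differs from one unjoined to [y]. So either one end
     is joined to all of [Q], or both miss the same single point and the pair sends 8. *)
  have key p1 p2 p3 p4 p5 :
      perm_eq [:: p1; p2; p3; p4; p5] Q -> 1 <= w p1 x + w p2 y.
    move=> pQ; have := min2 (u := p5) (M := (p1, x) :: (p2, y) :: (p3, p4) :: z').
    rewrite !weight_cons wz' /= (perm_trans _ MV).
      by have := w1 p3 p4; lia.
    perm_lia_with pQ.
  have := key a b c d u ltac:(perm_lia); have := key b a c d u ltac:(perm_lia).
  have := key a c b d u ltac:(perm_lia); have := key c a b d u ltac:(perm_lia).
  have := key a d b c u ltac:(perm_lia); have := key d a b c u ltac:(perm_lia).
  have := key a u b c d ltac:(perm_lia); have := key u a b c d ltac:(perm_lia).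
  have := key b c a d u ltac:(perm_lia); have := key c b a d u ltac:(perm_lia).
  have := key b d a c u ltac:(perm_lia); have := key d b a c u ltac:(perm_lia).
  have := key b u a c d ltac:(perm_lia); have := key u b a c d ltac:(perm_lia).
  have := key c d a b u ltac:(perm_lia); have := key d c a b u ltac:(perm_lia).
  have := key c u a b d ltac:(perm_lia); have := key u c a b d ltac:(perm_lia).
  have := key d u a b c ltac:(perm_lia); have := key u d a b c ltac:(perm_lia).
  rewrite /cross !big_cons !big_nil.
  move: (w1 a x) (w1 b x) (w1 c x) (w1 d x) (w1 u x).
  move: (w1 a y) (w1 b y) (w1 c y) (w1 d y) (w1 u y) => *.
  by split; lia.
have crQ2 x y : cross w Q [:: x; y] = cross w Q [:: x] + cross w Q [:: y].
  by rewrite /cross !big_cons !big_nil; lia.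
have crQ1 x : cross w Q [:: x] <= 5.
  rewrite /cross !big_cons !big_nil.
  by move: (w1 a x) (w1 b x) (w1 c x) (w1 d x) (w1 u x); lia.
(* A zero-weight pair of [z] sends at least 5 to the K5 on [Q]; if it sends at
   most 7 then one of its ends sends at most 2, so two such pairs cannot be
   re-paired at no cost. *)
pose light f := cross w Q [:: f.1; f.2] <= 7.
have := @cross_light_ge Q z light _ _.
have H1 f : f \in z -> (if light f then 5 else 8) <= cross w Q [:: f.1; f.2].
  move=> fz; case: ifP; rewrite /light; last by lia.
  move=> _; have [] // := zero_edge f.1 f.2 (rem f z) (perm_rem_flat fz MV).
  by move: wz; rewrite (perm_weight _ (perm_to_rem fz)) weight_cons; lia.
have H2 : pairwise (fun e f => light e ==> light f ==>
                         (1 <= cross w [:: e.1; e.2] [:: f.1; f.2])) z.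
  apply: pairwise_perm => -[x y] [x' y'] z' zz'.
  apply/implyP=> lxy; apply/implyP=> lxy'; case: leqP => // cr0.
  have {}MV : perm_eq (Q ++ [:: x; y; x'; y'] ++ flat z') (enum V).
    by rewrite (perm_trans _ MV) // perm_cat2l perm_sym (perm_flat zz').
  move: wz; rewrite (perm_weight _ zz') !weight_cons /= => wz.
  move: cr0; rewrite /cross !big_cons !big_nil /= => cr0.
  have zero p q p' q' : perm_eq [:: p; q; p'; q'] [:: x; y; x'; y'] ->
      w p' q' = 0 -> 5 <= cross w Q [:: p; q] /\
      (cross w Q [:: p; q] <= 7 -> cross w Q [:: p] <= 2 \/ cross w Q [:: q] <= 2).
    move=> pq w'; apply: (zero_edge _ _ ((p', q') :: z')).
      rewrite (perm_trans _ MV) // perm_cat2l.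
      perm_lia_with pq.
    by rewrite weight_cons w' /=; lia.
  (* The weak ends of the two pairs, sending at most 2 each, would form a zero pair sending at most
     4 instead of 5. *)
  have z1 := zero x y x' y' ltac:(perm_lia) ltac:(lia).
  have z2 := zero x' y' x y ltac:(perm_lia) ltac:(lia).
  have z3 := zero x x' y y' ltac:(perm_lia) ltac:(lia).
  have z4 := zero y y' x x' ltac:(perm_lia) ltac:(lia).
  have z5 := zero x y' y x' ltac:(perm_lia) ltac:(lia).
  have z6 := zero y x' x y' ltac:(perm_lia) ltac:(lia).
  move: lxy lxy' z1 z2 z3 z4 z5 z6; rewrite /light /= !crQ2.
  move: (crQ1 x) (crQ1 y) (crQ1 x') (crQ1 y').
  move: (cross _ _ [:: x]) (cross _ _ [:: y]) (cross _ _ [:: x']) (cross _ _ [:: y']).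
  by lia.
move=> /(_ H1 H2) bnd.
have szV : #|V| = (size z).*2 + 5.
  by rewrite cardE -(perm_size MV) size_cat size_flat /= addnC.
have crQQ : cross w Q Q = 20.
  have E1 := K5 a b c d u ltac:(perm_lia); have E2 := K5 a c b d u ltac:(perm_lia).
  have E3 := K5 a d b c u ltac:(perm_lia); have E4 := K5 a u b c d ltac:(perm_lia).
  have E5 := K5 b c a d u ltac:(perm_lia); have E6 := K5 b d a c u ltac:(perm_lia).
  have E7 := K5 b u a c d ltac:(perm_lia); have E8 := K5 c d a b u ltac:(perm_lia).
  have E9 := K5 c u a b d ltac:(perm_lia); have E10 := K5 d u a b c ltac:(perm_lia).
  rewrite /cross !big_cons !big_nil !w0 (wC b a) (wC c a) (wC d a) (wC u a).
  rewrite (wC c b) (wC d b) (wC u b) (wC d c) (wC u c) (wC u d).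
  by rewrite E1 E2 E3 E4 E5 E6 E7 E8 E9 E10.
move: small; rewrite -(total_perm _ MV) cross_cat // crQQ szV.
have := count_size light z; have {szV}V13 : 4 <= size z by rewrite szV in V13; lia.
move: bnd; set A := cross w Q _; set B := cross w _ _.
(* With [s] light pairs among [m], the total is at least [20 + 16 m + s^2 - 7 s], to be compared
   with [12 m + 24]. As [s^2 - 7 s >= -12] for integers, [m >= 4] suffices, that is, at least 13
   points. *)
move: A B (count _ _) (size z) V13 => A B s m; rewrite -muln2.
by case: (leqP s 3) => [|s4]; [case: s => [|[|[|[|]]]] //; lia | nia].
Qed.

End Tight.

Lemma odd_matching_contra w : (forall a b, w a b = w b a) -> (forall a, w a a = 0) ->
  odd #|V| -> 13 <= #|V| -> near_perfect_ge2 w -> 6 * #|V|.-1 <= wtotal w.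
Proof.
move=> + + V_odd V13; have [n] := ubnP (wtotal w).
elim: n w => // n IH w lt_n wC w0 min2; case: leqP => // small; exfalso.
have tight x y : 0 < w x y -> ~ ~ exists u M,
    perm_eq (u :: flat ((x, y) :: M)) (enum V) /\ w x y + weight w M = 2.
  move=> wxy ntight; have := total_decr wxy.
  have xy : x != y by apply: contraTneq wxy => ->; rewrite w0.
  have: 6 * #|V|.-1 <= wtotal (decr w x y).
    apply: IH; first by have := total_decr wxy; lia.
    - exact: decr_sym.
    - by move=> a; rewrite /decr w0.
    apply: near_perfect_ge2_decr => // u M MV wM; apply: ntight.
    by exists u, M.
  lia.
have [x [y wxy]] : exists x y, 0 < w x y.
  have: 0 < #|V| by lia.
  rewrite cardE; case E: (enum V) => [|u s] // _.
  have /weight_gt0[[x y] _ wxy] : 0 < weight w (pairup s).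
    apply: ltnW; apply: (min2 u); rewrite pairupK ?E //.
    by move: V_odd; rewrite cardE E.
  by exists x, y.
have no2 a b : w a b <> 2 by move=> /(total_edge2 wC w0 min2 tight); lia.
have w1 a b : w a b <= 1.
  by have := weight_le2 tight a b; have := no2 a b; lia.
by have := total_edge1 wC w0 min2 tight w1 V13 wxy; lia.
Qed.

Lemma odd_matching w : (forall a b, w a b = w b a) -> (forall a, w a a = 0) ->
  odd #|V| -> 13 <= #|V| -> wtotal w < 6 * #|V|.-1 ->
  exists u M, perm_eq (u :: flat M) (enum V) /\ weight w M <= 1.
Proof.
move=> wC w0 V_odd V13 small.
case: (boolP (all (fun s => 2 <= weight w (pairup (behead s))) (permutations (enum V)))).
  move/allP=> min2.
  suff: near_perfect_ge2 w by move/(odd_matching_contra wC w0 V_odd V13); lia.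
  move=> u M MV; have := min2 (u :: flat M); rewrite /= flatK; apply.
  by rewrite mem_permutations.
case/allPn=> s; rewrite mem_permutations -ltnNge => sV ws.
have szs : size s = #|V| by rewrite cardE (perm_size sV).
case: s sV ws szs => [|u s] sV ws szs; first by rewrite -szs in V_odd.
exists u, (pairup s); rewrite pairupK //.
by move: V_odd; rewrite -szs.
Qed.

End OddMatching.

(** * From a light matching of colors to an extension of the precoloring *)

Section Extension.
Variables (T : finType) (e : rel T) (P : {set T}) (d : T -> nat).
Hypotheses (eC : symmetric e).

(** These are the sets that may block a class owning the colors [a] and [b]. The clause [a != b]
    gives the zero diagonal that [odd_matching] asks for. *)
Definition conflicts a b : {set {set T}} :=
  [set s in DG e P 2 | (a != b) &&
     [exists x in s, exists y in s, (d x == a) && (d y == b)]].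

Lemma conflicts_sym a b : conflicts a b = conflicts b a.
Proof.
apply/setP=> s; rewrite !inE; congr (_ && (_ && _)).
  by rewrite eq_sym.
by apply/idP/idP => /exists_inP[x xs /exists_inP[y ys /andP[dx dy]]];
  apply/exists_inP; exists y => //; apply/exists_inP; exists x => //; rewrite dx dy.
Qed.

Lemma common_neighbour_DG v x y : x \in P -> y \in P -> x != y ->
  e v x -> e v y -> [set x; y] \in DG e P 2.
Proof.
move=> xP yP xy vx vy; rewrite inE cards2 xy andbT; apply/andP; split.
  by apply/subsetP=> z; rewrite !inE => /orP[] /eqP->.
have near a b : e v a -> e v b -> within e 2 a b.
  move=> va vb; apply/orP; right; apply/existsP; exists v; rewrite eC va /=.
  by apply/orP; right; apply/existsP; exists b; rewrite vb eqxx.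
apply/forall_inP=> a; rewrite !inE => /orP[] /eqP->;
  by apply/forall_inP=> b; rewrite !inE => /orP[] /eqP->; apply: near.
Qed.

Lemma common_neighbour_conflict v x y : x \in P -> y \in P -> d x <> d y ->
  e v x -> e v y -> [set x; y] \in conflicts (d x) (d y).
Proof.
move=> xP yP dxy vx vy; have xy : x != y by apply: contra_notN dxy => /eqP->.
rewrite inE (common_neighbour_DG xP yP xy vx vy); move/eqP: dxy => -> /=.
apply/exists_inP; exists x; rewrite ?inE ?eqxx //.
by apply/exists_inP; exists y; rewrite ?inE ?eqxx ?orbT.
Qed.

(** A set [{x, y}] carries one unordered pair of colors, so it is counted at most for [(d x, d y)]
    and [(d y, d x)]. *)
Lemma sum_conflicts n :
  wtotal (fun a b : 'I_n => #|conflicts a.+1 b.+1|) <= 2 * #|DG e P 2|.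
Proof.
pose F (s : {set T}) (a b : 'I_n) : nat := (s \in conflicts a.+1 b.+1).
have -> : wtotal (fun a b : 'I_n => #|conflicts a.+1 b.+1|) =
    \sum_(s in DG e P 2) \sum_a \sum_b F s a b.
  rewrite /wtotal [RHS]exchange_big /=; apply: eq_bigr => a _.
  rewrite [RHS]exchange_big /=; apply: eq_bigr => b _.
  rewrite -sum1_card big_mkcond [RHS]big_mkcond; apply: eq_bigr => s _.
  by rewrite /F inE; case: (s \in DG e P 2) => //=; case: ifP.
rewrite mulnC -sum_nat_const; apply: leq_sum => s; rewrite inE => /andP[/andP[_ s2] _].
have /cards2P[x [y [_ ->]]] : #|s| == 2 by [].
have one c : \sum_(a < n) (a.+1 == c) <= 1.
  rewrite -big_mkcond sum1dep_card; apply/card_le1_eqP => a b.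
  by rewrite !inE => /eqP <- /eqP [E]; apply/val_inj.
have ind (u v : T) : \sum_(a < n) \sum_(b < n) (a.+1 == d u) * (b.+1 == d v) <= 1.
  under eq_bigr => a _ do rewrite -big_distrr /=.
  by rewrite -big_distrl /=; apply: leq_mul (one _) (one _).
have := leq_add (ind x y) (ind y x); apply: leq_trans.
rewrite -big_split leq_sum // => a _; rewrite -big_split leq_sum // => b _ /=.
rewrite /F inE; case: (_ \in DG _ _ _) => //=; case: (a.+1 =P b.+1) => //= ab.
case: exists_inP => //= -[u + /exists_inP[v + /andP[/eqP du /eqP dv]]].
by rewrite !inE => /orP[]/eqP eu /orP[]/eqP ev; subst u v;
  rewrite ?du ?dv ?eqxx ?addn1 // in ab *; rewrite -du -dv in ab.
Qed.

(** Distinct classes draw on disjoint sets of colors, so only neighbors in [P] matter. Fresh colors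
    exceed [n] and cannot meet [d]; in a class owning a pair, [noconf] leaves one of its two colors
    free. *)
Lemma extend_by_pairs n r (c : T -> nat) (M : seq (nat * nat)) :
  (forall v, c v < r) -> (forall x y, e x y -> c x <> c y) ->
  precoloring e P n d -> uniq (flat M) -> size M <= r ->
  {in flat M, forall a, 1 <= a <= n} ->
  (forall v x y, c v < size M -> x \in P -> y \in P -> e v x -> e v y ->
     d x = (nth (0, 0) M (c v)).1 -> d y = (nth (0, 0) M (c v)).2 -> False) ->
  extends_to e P d (n + (r - size M)).
Proof.
move=> cr cP [dn dP] uM sM Mn noconf.
pose p v := nth (0, 0) M (c v).
pose g v := if c v < size M then
    (if [exists x in P, e v x && (d x == (p v).1)] then (p v).2 else (p v).1)
  (* Classes are numbered from 0, so the first fresh color is [n + 1]. *)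
  else n + (c v - size M).+1.
have gp v : c v < size M -> g v \in [:: (p v).1; (p v).2].
  by rewrite /g => ->; case: ifP; rewrite !inE eqxx ?orbT.
have gn v : c v < size M -> 1 <= g v <= n.
  move=> cv; apply: Mn; have := gp v cv.
  have /mem_flat/andP[p1 p2] : p v \in M by apply: mem_nth.
  by rewrite !inE => /orP[]/eqP->.
have gN v : size M <= c v -> g v = n + (c v - size M).+1.
  by rewrite /g ltnNge => ->.
have gd v x : x \in P -> e v x -> g v <> d x.
  move=> xP vx; case: (ltnP (c v) (size M)) => cv; last first.
    by have := gN v cv; have := dn x xP; lia.
  rewrite /g cv; case: ifP => [/exists_inP[y yP /andP[vy /eqP dy]] dx|nex dx].
    by apply: (noconf v y x).
  by move/exists_inP: nex; apply; exists x; rewrite // vx /= dx.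
have gg u v : e u v -> g u <> g v.
  move=> uv E; have := cP _ _ uv.
  case: (ltnP (c u) (size M)) => cu; case: (ltnP (c v) (size M)) => cv.
  - by apply; apply: (uniq_flat_disjoint uM cu cv (gp u cu)); rewrite E; apply: gp.
  - by have := gn u cu; have := gN v cv; lia.
  - by have := gn v cv; have := gN u cu; lia.
  - by have := gN v cv; have := gN u cu; lia.
exists (fun v => if v \in P then d v else g v); split; last by move=> v ->.
split=> [v|x y xy].
  case: ifP => [/dn|_]; first by lia.
  case: (ltnP (c v) (size M)) => cv; first by have := gn v cv; lia.
  by rewrite gN //; have := cr v; lia.
case: ifP => xP; case: ifP => yP; [exact: dP | | exact: gd | exact: gg].
by move=> E; apply: (gd y x); rewrite // eC.
Qed.

Lemma extend_from_matching n r (M : seq (nat * nat)) :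
  chi_le e r -> precoloring e P n d -> uniq (flat M) ->
  {in flat M, forall a, 1 <= a <= n} -> size M <= r ->
  weight (fun a b => #|conflicts a b|) M <= 1 ->
  extends_to e P d (n + (r - size M)).
Proof.
move=> [f [fr fP]] dn uM Mn sM wM; set w := fun a b => _ in wM.
have diff N i : uniq (flat N) -> i < size N -> (nth (0, 0) N i).1 <> (nth (0, 0) N i).2.
  move=> uN iN /eqP; have [<- <-] := nth_flat iN.
  by rewrite nth_uniq ?size_flat ?ltn_Sdouble ?ltn_double //; lia.
have free v x y a b : x \in P -> y \in P -> e v x -> e v y -> d x = a -> d y = b ->
    a <> b -> w a b <> 0.
  move=> xP yP vx vy <- <- dxy /cards0_eq E.
  by have := common_neighbour_conflict xP yP dxy vx vy; rewrite E inE.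
case: (posnP (weight w M)) => [wM0|wpos].
  apply: (@extend_by_pairs _ _ (fun v => (f v).-1)) => //.
  - by move=> v; have := fr v; lia.
  - by move=> x y xy; have := fP _ _ xy; have := fr x; have := fr y; lia.
  move=> v x y cv xP yP vx vy dx dy.
  apply: (free _ _ _ _ _ xP yP vx vy dx dy); first exact: diff.
  by apply: (weight0_mem wM0); apply: mem_nth.
have [p pM wp] := weight_gt0 wpos; have MN := perm_to_rem pM.
move: (rem p M) MN => N MN; rewrite (perm_size MN).
have uN : uniq (flat (p :: N)) by rewrite -(perm_uniq (perm_flat MN)).
have [wp1 wN] : w p.1 p.2 = 1 /\ weight w N = 0.
  by move: wM; rewrite (perm_weight _ MN) weight_cons; lia.
have /cards1P[s sE] : #|conflicts p.1 p.2| == 1 by apply/eqP.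
have : s \in conflicts p.1 p.2 by rewrite sE inE.
rewrite !inE => /andP[/andP[/andP[_ /eqP s2] _] _].
have [x0 x0s] : exists x0, x0 \in s by apply/card_gt0P; rewrite s2.
(* The class of [x0] has no vertex adjacent to [x0], so the colors of the only
   conflicting pair can be given to that class, renumbered as class 0. *)
pose c v := if f v == f x0 then 0 else if f v == 1 then (f x0).-1 else (f v).-1.
apply: (@extend_by_pairs _ _ c) => //.
- by move=> v; rewrite /c; have := fr v; have := fr x0; do ?case: ifP => ?; lia.
- move=> x y xy; have := fP _ _ xy; have := fr x; have := fr y; have := fr x0.
  by rewrite /c; do ?case: ifP => ?; lia.
- by rewrite -(perm_size MN).
- by move=> a; rewrite -(perm_mem (perm_flat MN)); apply: Mn.
move=> v x y cv xP yP vx vy dx dy; have dxy := diff _ _ uN cv.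
case: (posnP (c v)) => cv0; last first.
  apply: (free _ _ _ _ _ xP yP vx vy dx dy dxy); apply: (weight0_mem wN).
  by case: (c v) cv0 cv => //= i _; apply: mem_nth.
move: dx dy dxy; rewrite cv0 /= => dx dy; rewrite -dx -dy => dxy.
(* The conflict at [v] must be [s], so [v] is adjacent to [x0], although [v] lies in the class of
   [x0]. *)
have := common_neighbour_conflict xP yP dxy vx vy; rewrite dx dy sE inE => /eqP E.
have fv : f v = f x0.
  by move: cv0; rewrite /c; have := fr v; have := fr x0; do ?case: ifP => ?; lia.
by move: x0s; rewrite -E !inE => /orP[]/eqP E0; [move: vx | move: vy];
  rewrite -E0 => /fP; rewrite fv.
Qed.

Lemma extend_from_ord_matching n r m (M : seq ('I_n * 'I_n)) :
  chi_le e r -> precoloring e P n d -> uniq (flat M) -> size M = m -> m <= r ->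
  weight (fun a b : 'I_n => #|conflicts a.+1 b.+1|) M <= 1 ->
  extends_to e P d (n + (r - m)).
Proof.
move=> er dn uM <- sM wM; pose g (a : 'I_n) := a.+1.
rewrite -(size_map (fun p => (g p.1, g p.2)) M).
apply: extend_from_matching; rewrite ?size_map ?flat_map_pair //.
- by rewrite map_inj_uniq // => a b [/val_inj].
- by move=> _ /mapP[a _ ->]; rewrite /g ltn_ord.
- by rewrite /weight big_map.
Qed.

End Extension.

Theorem theorem5 (T : finType) (e : rel T) (r k : nat) (P : {set T}) (d : T -> nat) :
  symmetric e -> irreflexive e ->
  0 < k -> 2 <= r -> k <= r ->
  chi_le e r ->
  precoloring e P (r + k) d ->
  (~~ odd (r + k) -> #|DG e P 2| < 2 * (r + k - 1) ->
     extends_to e P d ((3 * r + k)./2)) /\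
  (odd (r + k) -> 13 <= r + k -> #|DG e P 2| < 3 * (r + k - 1) ->
     extends_to e P d ((3 * r + k + 1)./2)).
Proof.
move=> eC _ k0 r2 kr er dn; set n := r + k in dn *.
pose w (a b : 'I_n) := #|conflicts e P d a.+1 b.+1|.
have wC a b : w a b = w b a by rewrite /w conflicts_sym.
have w0 a : w a a = 0.
  by rewrite /w; apply/eqP; rewrite cards_eq0; apply/eqP/setP=> s; rewrite !inE eqxx andbF.
have := sum_conflicts e P d n; rewrite -/w => wD.
have En : #|'I_n| = n by rewrite card_ord.
split=> [n_even D2 | n_odd n13 D3].
  (* [wtotal] counts ordered pairs, so [2 (n - 1)] for sets becomes [4 (n - 1)] here. *)
  have [|| M MV wM] := even_matching wC; rewrite ?En //; first by lia.
  have uM : uniq (flat M) by rewrite (perm_uniq MV) enum_uniq.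
  have [m szM sM] : exists2 m, size M = m & m.*2 = n.
    by exists (size M) => //; rewrite -size_flat (perm_size MV) -cardE.
  have -> : (3 * r + k)./2 = n + (r - m) by rewrite /n in sM *; lia.
  (* Here [k <= r] ensures [m <= r]: there are enough classes for the pairs. *)
  by apply: extend_from_ord_matching szM _ wM => //; rewrite /n in sM; lia.
have [|||u [M [MV wM]]] := odd_matching wC w0; rewrite ?En //; first by lia.
have /andP[_ uM] : uniq (u :: flat M) by rewrite (perm_uniq MV) enum_uniq.
have [m szM sM] : exists2 m, size M = m & n = m.*2.+1.
  by exists (size M) => //; rewrite -(size_near_perfect MV) En.
have -> : (3 * r + k + 1)./2 = n + (r - m) by rewrite /n in sM *; lia.
by apply: extend_from_ord_matching szM _ wM => //; rewrite /n in sM; lia.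
Qed.
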